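(* If $G$ is a finite undirected graph such that $\mathrm{MH}_{2,k}(G,\mathbb{Z})=0$ for all $k>2$, then the Grigor'yan--Lin--Muranov--Yau fundamental group $\pi_1^{\mathsf{GLMY}}(G,x)$ is trivial for any vertex $x$.
   Context: A digraph consists of a set of vertices and a set of arrows, which are ordered pairs of distinct vertices. An undirected graph is a digraph such that for any arrow $(x,y)$ the pair $(y,x)$ is also an arrow. A path of length $n\ge 0$ is a tuple of vertices $(p_0,\dots,p_n)$ such that each $(p_i,p_{i+1})$ is an arrow; $d(x,y)$ is the infimum of lengths of paths from $x$ to $y$ ($\infty$ if there are none). Put $|x_0,\dots,x_n|=\sum_{i=0}^{n-1}d(x_i,x_{i+1})$. Magnitude homology: $\mathrm{MC}_{n,\ell}(G,\mathbb{Z})$ is the free abelian group on tuples of vertices with $x_i\neq x_{i+1}$ and $|x_0,\dots,x_n|=\ell$; the differential is $\sum_{i=0}^n(-1)^i\partial_{n,i}$, where $\partial_{n,i}$ deletes $x_i$ if the resulting tuple still has norm $\ell$ and is $0$ otherwise. $\mathrm{MH}_{n,\ell}(G,\mathbb{Z})=H_n(\mathrm{MC}_{\bullet,\ell}(G,\mathbb{Z}))$. $\pi_1^{\mathsf{GLMY}}(G,x)$ is the fundamental group of a based digraph introduced by Grigor'yan--Lin--Muranov--Yau. It is known to be isomorphic to $\pi_1^2(G,x)$, the fundamental group at $x$ of the simplicial set $\mathscr{N}^2(G)$ whose $n$-simplices are the tuples of vertices $(x_0,\dots,x_n)$ (repetitions allowed) with $|x_0,\dots,x_n|\le2$, with face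 maps deleting a vertex and degeneracy maps doubling a vertex; this description may be taken as the definition. *)

(* Defs.v *)
From HB Require Import structures.
From Stdlib Require Import Relation_Operators.
From mathcomp Require Import boolp freeg.
From mathcomp Require Import all_boot all_order all_algebra generic_quotient zify.

Set Implicit Arguments.
Unset Strict Implicit.
Unset Printing Implicit Defensive.

Import GRing.Theory.

(* Extended naturals are represented by [option nat], [None] being infinity. *)

Definition eadd (a b : option nat) : option nat :=
  if a is Some m then (if b is Some n then Some (m + n) else None) else None.

Definition ele (a b : option nat) : bool :=
  if b is Some n then (if a is Some m then m <= n else false) else true.

Section Norm.
Variables (T : choiceType) (e : rel T).

Definition has_path (x y : T) (n : nat) : Prop :=
  exists p : seq T, [/\ size p = n, path e x p & last x p = y].

Definition dist (x y : T) : option nat :=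
  if pselect (exists n, `[< has_path x y n >]) is left xy_conn
  then Some (ex_minn xy_conn) else None.

Fixpoint norm_from (x : T) (s : seq T) : option nat :=
  if s is y :: s' then eadd (dist x y) (norm_from y s') else Some 0.

Definition norm (s : seq T) : option nat :=
  if s is x :: s' then norm_from x s' else Some 0.

End Norm.

Section EnatTheory.

Lemma eaddA : associative eadd.
Proof. by case=> [a|] [b|] [c|] //=; rewrite addnA. Qed.

Lemma eadd0n : left_id (Some 0) eadd. Proof. by case. Qed.

Lemma ele_refl : reflexive ele. Proof. by case=> /=. Qed.

Lemma ele_trans : transitive ele.
Proof. by case=> [b|] [a|] [c|] //=; apply: leq_trans. Qed.

Lemma ele_add2 a b c d : ele a c -> ele b d -> ele (eadd a b) (eadd c d).
Proof. by case: a b c d => [a|] [b|] [c|] [d|] //=; apply: leq_add. Qed.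

Lemma ele_addl a b : ele b (eadd a b).
Proof. by case: a b => [a|] [b|] //=; apply: leq_addl. Qed.

Lemma ele_addr a b : ele a (eadd a b).
Proof. by case: a b => [a|] [b|] //=; apply: leq_addr. Qed.

End EnatTheory.

Section NormTheory.
Variables (T : choiceType) (e : rel T).
Local Notation dist := (dist e).
Local Notation norm_from := (norm_from e).
Local Notation norm := (norm e).

Lemma ele_dist x y n : has_path e x y n -> ele (dist x y) (Some n).
Proof.
rewrite /dist => pxy; case: pselect => [ex|[]]; last by exists n; apply/asboolP.
by case: ex_minnP => m _ /(_ n); apply; apply/asboolP.
Qed.

Lemma dist_path x y n : dist x y = Some n -> has_path e x y n.
Proof.
rewrite /dist; case: pselect => // ex [<-].
by case: ex_minnP => m /asboolP.
Qed.

Lemma distxx x : dist x x = Some 0.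
Proof.
have /ele_dist : has_path e x x 0 by exists [::].
by case: (dist x x) => [[]|].
Qed.

Lemma dist_triangle y x z : ele (dist x z) (eadd (dist x y) (dist y z)).
Proof.
case xy: (dist x y) => [m|//]; case yz: (dist y z) => [n|//].
have [p [<- xp py]] := dist_path xy; have [q [<- yq qz]] := dist_path yz.
apply: ele_dist; exists (p ++ q).
by rewrite size_cat cat_path last_cat py xp yq.
Qed.

Lemma norm_del i (s : seq T) : ele (norm (take i s ++ drop i.+1 s)) (norm s).
Proof.
case: s => [|x s]; first by [].
case: i => [|i] /=.
  by case: s => [|y s] //=; apply: ele_addl.
elim: s i x => [|y s IHs] [|i] x //=.
  case: s IHs => [|z s] _ /=; first by case: (dist x y).
  by rewrite eaddA; apply: ele_add2 (dist_triangle _ _ _) (ele_refl _).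
by apply: ele_add2 (ele_refl _) _; apply: IHs.
Qed.

Lemma norm_dup i (s : seq T) : norm (take i.+1 s ++ drop i s) = norm s.
Proof.
case: s => [|x s]; first by [].
case: i => [|i] /=; first by rewrite take0 /= distxx eadd0n.
elim: s i x => [|y s IHs] [|i] x //=; last by rewrite IHs.
by rewrite take0 /= distxx eadd0n.
Qed.

End NormTheory.

Section Reindex.
Variable T : Type.

Definition tdel n (i : 'I_n.+1) (t : n.+1.-tuple T) : n.-tuple T :=
  [tuple tnth t (lift i j) | j < n].

(* [unbump i] sends both [i] and [i.+1] to [i]. *)
Definition tdup n (i : 'I_n.+1) (t : n.+1.-tuple T) : n.+2.-tuple T :=
  [tuple tnth t (inord (unbump i j)) | j < n.+2].

Lemma nth_tdel x n (i : 'I_n.+1) (t : n.+1.-tuple T) k :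
  nth x (tdel i t) k = nth x t (bump i k).
Proof.
have [lt_kn|le_nk] := ltnP k n; last first.
  by rewrite !nth_default ?size_tuple //; have := ltn_ord i; rewrite /bump; lia.
by rewrite -[k]/(val (Ordinal lt_kn)) -tnth_nth tnth_mktuple (tnth_nth x).
Qed.

Lemma nth_tdup x n (i : 'I_n.+1) (t : n.+1.-tuple T) k :
  nth x (tdup i t) k = nth x t (unbump i k).
Proof.
have lt_in := ltn_ord i.
have [lt_kn|le_nk] := ltnP k n.+2; last first.
  by rewrite !nth_default ?size_tuple //; rewrite /unbump; lia.
rewrite -[k]/(val (Ordinal lt_kn)) -tnth_nth tnth_mktuple (tnth_nth x) inordK //.
by rewrite /unbump /=; lia.
Qed.

Lemma tdelE n (i : 'I_n.+1) (t : n.+1.-tuple T) :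
  tdel i t = take i t ++ drop i.+1 t :> seq T.
Proof.
have x := thead t; have lt_in := ltn_ord i.
have st : size (take i t) = i by rewrite size_takel // size_tuple; lia.
apply: (@eq_from_nth _ x) => [|k _].
  by rewrite size_cat st size_drop !size_tuple; lia.
rewrite nth_tdel nth_cat st /bump; case: (leqP i k) => ik.
  by rewrite nth_drop; congr nth; lia.
by rewrite nth_take.
Qed.

Lemma tdupE n (i : 'I_n.+1) (t : n.+1.-tuple T) :
  tdup i t = take i.+1 t ++ drop i t :> seq T.
Proof.
have x := thead t; have lt_in := ltn_ord i.
have st : size (take i.+1 t) = i.+1 by rewrite size_takel // size_tuple.
apply: (@eq_from_nth _ x) => [|k _].
  by rewrite size_cat st size_drop !size_tuple; lia.
rewrite nth_tdup nth_cat st /unbump; case: (ltnP i k) => ik.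
  by rewrite ltnNge ik /= nth_drop; congr nth; lia.
by rewrite ltnS ik nth_take ?subn0 //; lia.
Qed.

End Reindex.

Section MagnitudeHomology.
Variables (T : choiceType) (e : rel T).
Local Open Scope ring_scope.

Definition mc_basis (n l : nat) :=
  {t : n.+1.-tuple T | sorted [rel x y | x != y] t && (norm e t == Some l)}.

Definition MC (n l : nat) := {freeg (mc_basis n l) / int}.

(* [insub] also tests that consecutive entries differ, but this holds
   automatically as soon as the deletion preserves the norm. *)
Definition mc_face n l (i : 'I_n.+2) (t : mc_basis n.+1 l) : MC n l :=
  if insub (tdel i (val t)) is Some s then << s >> else 0.

Definition mc_diff n l : MC n.+1 l -> MC n l :=
  fglift (fun t : mc_basis n.+1 l =>
            \sum_(i < n.+2) (-1) ^+ i *: mc_face i t : MC n l).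

Lemma mc_diff_additive n l : additive (@mc_diff n l).
Proof. exact: lift_is_additive. Qed.

Definition mc_cycle n l : {pred MC n l} :=
  match n return {pred MC n l} with
  | 0 => predT
  | n'.+1 => [pred c | mc_diff c == 0]
  end.

Lemma mc_cycle_zmod n l : zmod_closed (@mc_cycle n l).
Proof.
case: n => [|n] //; split=> [|c d]; rewrite !inE.
  by rewrite -(subrr 0) mc_diff_additive subrr.
by rewrite mc_diff_additive => /eqP-> /eqP->; rewrite subrr.
Qed.

HB.instance Definition _ n l :=
  GRing.isZmodClosed.Build (MC n l) (@mc_cycle n l) (@mc_cycle_zmod n l).

Record cycles n l := Cycle { cycle_val :> MC n l; _ : cycle_val \in @mc_cycle n l }.

HB.instance Definition _ n l := [isSub for @cycle_val n l].
HB.instance Definition _ n l := [Choice of cycles n l by <:].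
HB.instance Definition _ n l := [SubChoice_isSubZmodule of cycles n l by <:].

Definition mc_boundary n l : {pred cycles n l} :=
  [pred z : cycles n l | `[< exists c : MC n.+1 l, mc_diff c = val z >]].

Lemma mc_boundary_zmod n l : zmod_closed (@mc_boundary n l).
Proof.
split=> [|y z]; rewrite !inE.
  by apply/asboolP; exists 0; rewrite raddf0 -(subrr 0) mc_diff_additive subrr.
move=> /asboolP[c cy] /asboolP[d dz]; apply/asboolP; exists (c - d).
by rewrite mc_diff_additive cy dz raddfB.
Qed.

HB.instance Definition _ n l :=
  GRing.isZmodClosed.Build (cycles n l) (@mc_boundary n l) (@mc_boundary_zmod n l).

Definition MH (n l : nat) : zmodType := Quotient.quot (@mc_boundary n l).

End MagnitudeHomology.

Record sset := SSet {
  simp :> nat -> choiceType;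
  face : forall n, 'I_n.+2 -> simp n.+1 -> simp n;
  degen : forall n, 'I_n.+1 -> simp n -> simp n.+1;
  face_face : forall n (i j : 'I_n.+2) (s : simp n.+2), i <= j ->
    face i (face (lift ord0 j) s) = face j (face (widen_ord (leqnSn _) i) s);
  degen_degen : forall n (i j : 'I_n.+1) (s : simp n), i <= j ->
    degen (widen_ord (leqnSn _) i) (degen j s) = degen (lift ord0 j) (degen i s);
  face_degen_lt : forall n (i : 'I_n.+2) (j : 'I_n.+1) (s : simp n.+1), i <= j ->
    face (widen_ord (leqnSn _) i) (degen (lift ord0 j) s) = degen j (face i s);
  face_degen_eq : forall n (j : 'I_n.+1) (s : simp n),
    face (widen_ord (leqnSn _) j) (degen j s) = s;
  face_degen_eqS : forall n (j : 'I_n.+1) (s : simp n),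
    face (lift ord0 j) (degen j s) = s;
  face_degen_gt : forall n (i : 'I_n.+2) (j : 'I_n.+1) (s : simp n.+1), j < i ->
    face (lift ord0 i) (degen (widen_ord (leqnSn _) j) s) = degen j (face i s)
}.

(* Gabriel-Zisman: the vertex group at [x] of the groupoid generated by the
   1-simplices, with relations given by the 2-simplices and the degenerate
   1-simplices. A 1-simplex [u] goes from [d1 u] to [d0 u]; the letter
   [(true, u)] stands for [u] and [(false, u)] for its formal inverse. *)

Section FundamentalGroup.
Variable X : sset.

Definition letter : Type := bool * X 1.
HB.instance Definition _ := Choice.on letter.

Definition linv (a : letter) : letter := (~~ a.1, a.2).
Definition lsrc (a : letter) : X 0 := face (if a.1 then ord_max else ord0) a.2.
Definition ltgt (a : letter) : X 0 := lsrc (linv a).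

Fixpoint is_walk (x : X 0) (w : seq letter) (y : X 0) : bool :=
  if w is a :: w' then (lsrc a == x) && is_walk (ltgt a) w' y else x == y.

Inductive word_move : seq letter -> seq letter -> Prop :=
| MoveCancel u v a : word_move (u ++ [:: a; linv a] ++ v) (u ++ v)
| MoveDegen u v (x : X 0) :
    word_move (u ++ [:: (true, degen ord0 x)] ++ v) (u ++ v)
| MoveTriangle u v (s : X 2) :
    word_move (u ++ [:: (true, face (@Ordinal 3 1 isT) s)] ++ v)
              (u ++ [:: (true, face ord_max s); (true, face ord0 s)] ++ v).

Definition winv (w : seq letter) : seq letter := rev (map linv w).

Variable x0 : X 0.

Definition loop := {w : seq letter | is_walk x0 w x0}.
Definition Loop w (w_loop : is_walk x0 w x0) : loop := exist _ w w_loop.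

Definition homotopic : loop -> loop -> Prop :=
  clos_refl_sym_trans loop (fun p q => word_move (val p) (val q)).

Definition homotopicb (p q : loop) : bool := `[< homotopic p q >].

Lemma linvK : involutive linv.
Proof. by case=> b u; rewrite /linv negbK. Qed.

Lemma ltgt_inv a : ltgt (linv a) = lsrc a.
Proof. by rewrite /ltgt linvK. Qed.

Lemma walk_cat x y z u v : is_walk x u y -> is_walk y v z -> is_walk x (u ++ v) z.
Proof.
by elim: u x => [|a u IHu] x /= => [/eqP->|/andP[-> /IHu]].
Qed.

Lemma walk_inv x y u : is_walk x u y -> is_walk y (winv u) x.
Proof.
elim: u x => [|a u IHu] x /=; first by rewrite eq_sym.
case/andP=> /eqP <- /IHu yu; rewrite /winv /= rev_cons -cats1.
by apply: walk_cat yu _; rewrite /= ltgt_inv !eqxx.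
Qed.

Definition loop1 : loop := @Loop [::] (eqxx x0).

Definition loopM (p q : loop) : loop := Loop (walk_cat (valP p) (valP q)).

Definition loopV (p : loop) : loop := Loop (walk_inv (valP p)).

Lemma homotopic_refl p : homotopic p p. Proof. exact: rst_refl. Qed.

Lemma homotopic_sym p q : homotopic p q -> homotopic q p.
Proof. exact: rst_sym. Qed.

Lemma homotopic_trans q p r : homotopic p q -> homotopic q r -> homotopic p r.
Proof. exact: rst_trans. Qed.

Lemma homotopicb_equiv : equiv_class_of homotopicb.
Proof.
split=> [p|p q|q p r]; first exact/asboolP/homotopic_refl.
  by apply/asboolP/asboolP => /homotopic_sym.
by move=> /asboolP pq /asboolP qr; apply/asboolP/(homotopic_trans pq qr).
Qed.

Canonical homotopicb_equivrel := EquivRelPack homotopicb_equiv.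
Canonical homotopicb_encModRel := defaultEncModRel homotopicb.

Definition pi1 := {eq_quot homotopicb}%qT.

HB.instance Definition _ : EqQuotient loop homotopicb pi1 := EqQuotient.on pi1.
HB.instance Definition _ := Choice.on pi1.

Lemma pi1P (p q : loop) : (\pi_pi1 p = \pi_pi1 q)%qT <-> homotopic p q.
Proof.
by split=> [/eqquotP/asboolP|pq]; last exact/eqquotP/asboolP.
Qed.

Lemma word_move_cat u v w w' :
  word_move w w' -> word_move (u ++ w ++ v) (u ++ w' ++ v).
Proof.
case=> [u1 v1 a|u1 v1 x|u1 v1 s]; rewrite -!catA !(catA u u1).
- exact: MoveCancel.
- exact: MoveDegen.
- exact: MoveTriangle.
Qed.

Lemma homotopicMl r p q : homotopic p q -> homotopic (loopM r p) (loopM r q).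
Proof.
elim=> [{}p {}q pq|{}p|{}p {}q _|{}p s {}q _ IH1 _ IH2].
- by apply: rst_step; have := word_move_cat (val r) [::] pq; rewrite !cats0.
- exact: homotopic_refl.
- exact: homotopic_sym.
- exact: homotopic_trans IH1 IH2.
Qed.

Lemma homotopicMr r p q : homotopic p q -> homotopic (loopM p r) (loopM q r).
Proof.
elim=> [{}p {}q pq|{}p|{}p {}q _|{}p s {}q _ IH1 _ IH2].
- by apply: rst_step; have := word_move_cat [::] (val r) pq.
- exact: homotopic_refl.
- exact: homotopic_sym.
- exact: homotopic_trans IH1 IH2.
Qed.

Lemma homotopicM p q p' q' :
  homotopic p p' -> homotopic q q' -> homotopic (loopM p q) (loopM p' q').
Proof.
by move=> pp' qq'; apply: homotopic_trans (homotopicMr _ pp') (homotopicMl _ qq').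
Qed.

Lemma loopMA p q r : loopM p (loopM q r) = loopM (loopM p q) r.
Proof. by apply: val_inj; rewrite /= catA. Qed.

Lemma loop1M p : loopM loop1 p = p. Proof. exact: val_inj. Qed.

Lemma loopM1 p : loopM p loop1 = p.
Proof. by apply: val_inj; rewrite /= cats0. Qed.

Lemma winvK : involutive winv.
Proof.
by move=> w; rewrite /winv map_rev revK -map_comp map_id_in // => a _; apply: linvK.
Qed.

Lemma loopVK p : loopV (loopV p) = p.
Proof. by apply: val_inj; rewrite /= winvK. Qed.

Lemma loopMV p : homotopic (loopM p (loopV p)) loop1.
Proof.
suff walkMV w y (h : is_walk x0 (w ++ winv w) x0) :
    is_walk x0 w y -> homotopic (Loop h) loop1.
  exact: walkMV (valP p).
elim/last_ind: w y h => [|w a IHw] y h xwy.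
  have -> : Loop h = loop1 by exact: val_inj.
  exact: homotopic_refl.
have xw : is_walk x0 w (lsrc a).
  elim: w {IHw h} x0 xwy => [|b w IHw] x /=; first by case/andP=> /eqP->.
  by case/andP=> -> /IHw.
apply: (@homotopic_trans (Loop (walk_cat xw (walk_inv xw)))); last first.
  exact: IHw xw.
apply: rst_step => /=; rewrite /winv map_rcons rev_rcons cat_rcons.
exact: (MoveCancel w (winv w) a).
Qed.

Lemma loopVM p : homotopic (loopM (loopV p) p) loop1.
Proof. by have := loopMV (loopV p); rewrite loopVK. Qed.

Lemma homotopicV p q : homotopic p q -> homotopic (loopV p) (loopV q).
Proof.
move=> pq; rewrite -[loopV p]loopM1.
apply: homotopic_trans (homotopicMl _ (homotopic_sym (loopMV q))) _.
rewrite loopMA -[in X in homotopic _ X](loop1M (loopV q)); apply: homotopicMr.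
apply: homotopic_trans (loopVM p).
by apply: homotopicMl; apply: homotopic_sym.
Qed.

Local Open Scope quotient_scope.

Definition pi1_one : pi1 := \pi_pi1 loop1.
Definition pi1_mul (a b : pi1) : pi1 := \pi_pi1 (loopM (repr a) (repr b)).
Definition pi1_inv (a : pi1) : pi1 := \pi_pi1 (loopV (repr a)).

Lemma pi1_reprK (p : loop) : homotopic (repr (\pi_pi1 p)) p.
Proof. by apply/pi1P; rewrite reprK. Qed.

Lemma pi1_mulE p q : pi1_mul (\pi_pi1 p) (\pi_pi1 q) = \pi_pi1 (loopM p q).
Proof. by apply/pi1P/homotopicM; apply: pi1_reprK. Qed.

Lemma pi1_invE p : pi1_inv (\pi_pi1 p) = \pi_pi1 (loopV p).
Proof. by apply/pi1P/homotopicV/pi1_reprK. Qed.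

Lemma pi1_surj (a : pi1) : exists p, a = \pi_pi1 p.
Proof. by exists (repr a); rewrite reprK. Qed.

Lemma pi1_mulA : associative pi1_mul.
Proof.
move=> a b c; have [p ->] := pi1_surj a; have [q ->] := pi1_surj b.
by have [r ->] := pi1_surj c; rewrite !pi1_mulE loopMA.
Qed.

Lemma pi1_mul1g : left_id pi1_one pi1_mul.
Proof. by move=> a; have [p ->] := pi1_surj a; rewrite pi1_mulE loop1M. Qed.

Lemma pi1_mulg1 : right_id pi1_one pi1_mul.
Proof. by move=> a; have [p ->] := pi1_surj a; rewrite pi1_mulE loopM1. Qed.

Lemma pi1_mulVg : left_inverse pi1_one pi1_inv pi1_mul.
Proof.
by move=> a; have [p ->] := pi1_surj a; rewrite pi1_invE pi1_mulE; apply/pi1P/loopVM.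
Qed.

Lemma pi1_mulgV : right_inverse pi1_one pi1_inv pi1_mul.
Proof.
by move=> a; have [p ->] := pi1_surj a; rewrite pi1_invE pi1_mulE; apply/pi1P/loopMV.
Qed.

HB.instance Definition _ :=
  isGroup.Build pi1 pi1_mulA pi1_mul1g pi1_mulg1 pi1_mulVg pi1_mulgV.

End FundamentalGroup.

Section Nerve.
Variables (T : choiceType) (e : rel T) (l : nat).

Definition nerve_simp (n : nat) := {t : n.+1.-tuple T | ele (norm e t) (Some l)}.

Lemma nerve_face_subproof n (i : 'I_n.+2) (t : nerve_simp n.+1) :
  ele (norm e (tdel i (val t))) (Some l).
Proof. by rewrite tdelE; apply: ele_trans (norm_del _ _ _) (valP t). Qed.

Definition nerve_face n (i : 'I_n.+2) (t : nerve_simp n.+1) : nerve_simp n :=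
  exist _ (tdel i (val t)) (nerve_face_subproof i t).

Lemma nerve_degen_subproof n (i : 'I_n.+1) (t : nerve_simp n) :
  ele (norm e (tdup i (val t))) (Some l).
Proof. by rewrite tdupE norm_dup; apply: valP t. Qed.

Definition nerve_degen n (i : 'I_n.+1) (t : nerve_simp n) : nerve_simp n.+1 :=
  exist _ (tdup i (val t)) (nerve_degen_subproof i t).

Lemma nth_nerve_face n (i : 'I_n.+2) (t : nerve_simp n.+1) x k :
  nth x (val (nerve_face i t)) k = nth x (val t) (bump i k).
Proof. exact: nth_tdel. Qed.

Lemma nth_nerve_degen n (i : 'I_n.+1) (t : nerve_simp n) x k :
  nth x (val (nerve_degen i t)) k = nth x (val t) (unbump i k).
Proof. exact: nth_tdup. Qed.

Lemma nerve_simp_eq n (s t : nerve_simp n) :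
  (forall x k, nth x (val s) k = nth x (val t) k) -> s = t.
Proof.
move=> eq_st; apply/val_inj/val_inj; apply: (@eq_from_nth _ (thead (val s))).
  by rewrite !size_tuple.
by move=> k _; apply: eq_st.
Qed.

Definition nerve : sset.
refine (@SSet nerve_simp nerve_face nerve_degen _ _ _ _ _ _).
all: try (move=> n i j s le_ij); try (move=> n j s).
all: apply: nerve_simp_eq => x k; rewrite !(nth_nerve_face, nth_nerve_degen).
all: by congr nth; rewrite /= /bump /unbump; lia.
Defined.

Lemma nerve_vertex_subproof (x : T) : ele (norm e [tuple x]) (Some l).
Proof. by []. Qed.

Definition nerve_vertex (x : T) : nerve 0 :=
  exist _ [tuple x] (nerve_vertex_subproof x).

End Nerve.

(* The Grigor'yan-Lin-Muranov-Yau fundamental group, through its description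
   as the fundamental group of the simplicial set of tuples of norm <= 2. *)
Definition pi1_GLMY (T : choiceType) (e : rel T) (x : T) : groupType :=
  pi1 (nerve_vertex e 2 x).

(* Main.v *)
From HB Require Import structures.
From Stdlib Require Import Relation_Operators.
Require Import Defs.
From mathcomp Require Import boolp freeg.
From mathcomp Require Import all_boot all_order all_algebra generic_quotient zify.

Set Implicit Arguments.
Unset Strict Implicit.
Unset Printing Implicit Defensive.

Import GRing.Theory.

(** Every loop of the simplicial set of tuples of norm at most 2 is homotopic
    to the word of an edge path of [e]: a 1-simplex of length 2 is a product
    of two edges by a triangle, and since [e] is symmetric the inverse of an
    edge is the reversed edge ([walk_edgesP]).  So it suffices to show that any
    two edge paths with the same ends are homotopic, and this is done by
    induction on a bound [k] for their lengths.  For [k = 2] both paths are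
    homotopic to the single 1-simplex joining their ends.

    For the step from [k >= 2] to [k.+1], let [c] be an edge path that is not
    homotopic to any path of length at most [k].  By induction the geodesics
    from [x] to [y] and from [y] to [z] have a well-defined class when both
    distances are at most [k], so a generator [(x, y, z)] of magnitude chains
    of length [k.+1] represents a class of paths from [x] to [z].  Let
    [class_count x c] be the functional that counts the generators starting at
    [x] and representing the class of [c].  It vanishes on boundaries
    ([class_count_boundary]): the differential of [(x, a, b, z)] is
    [(x, a, z) - (x, b, z)], both terms represent the path that runs through
    [x], [a], [b] and [z], and if one of the terms is missing, because
    deleting a vertex shortened the tuple, then that path is homotopic to a
    shorter one, hence not to [c].

    Now let [c] be an edge path of length [k.+1] from [x] to [z], let [y] be its
    first vertex after [x], and suppose that [c] is not homotopic to a shorter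
    path.  Then [(x, y, z)] is a generator, and [class_count x c] takes the
    value 1 on it.  If some path from [x] to [z] has length at most [k], then
    [(x, y, z)] is a cycle, hence a boundary, a contradiction
    ([hom_succ_short]).  Otherwise let [c'] be another path of length [k.+1]
    from [x] to [z], through [y']; then [(x, y, z) - (x, y', z)] is a cycle,
    hence a boundary, so [class_count x c] is also 1 on [(x, y', z)] and [c'] is
    homotopic to [c] ([hom_succ_succ]). *)

(** * Homotopy of walks in a simplicial set *)

Section WalkHomotopy.
Variable X : sset.
Implicit Types (x y z : X 0) (u v w : seq (letter X)).

(** Undoing a cancellation may insert a letter that does not compose with its
    neighbours, so every word of the chain is required to be a walk. *)
Definition walk_homotopic x y : seq (letter X) -> seq (letter X) -> Prop :=
  clos_refl_sym_trans _ (fun w w' =>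
    [/\ is_walk x w y, is_walk x w' y & word_move w w']).

Lemma walk_homotopic_is_walk x y w w' : walk_homotopic x y w w' ->
  is_walk x w y = is_walk x w' y.
Proof. by elim=> [? ? [-> ->]|//|//|? ? ? _ -> _ ->]. Qed.

Lemma walk_homotopic_cat x y z u u' v v' :
  is_walk x u y -> is_walk y v z ->
  walk_homotopic x y u u' -> walk_homotopic y z v v' ->
  walk_homotopic x z (u ++ v) (u' ++ v').
Proof.
move=> xu yv uu' vv'; apply: (@rst_trans _ _ _ (u' ++ v)).
  elim: uu' {xu} => [{}u {}u' [xu xu' m]|{}u|{}u {}u' _|u1 u2 u3 _ h1 _ h2].
  - apply: rst_step; split; try exact: walk_cat yv.
    exact: (word_move_cat [::] v m).
  - exact: rst_refl.
  - exact: rst_sym.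
  - exact: rst_trans h1 h2.
rewrite (walk_homotopic_is_walk uu') in xu.
elim: vv' {yv} => [{}v {}v' [yv yv' m]|{}v|{}v {}v' _|v1 v2 v3 _ h1 _ h2].
- apply: rst_step; split; try exact: walk_cat xu _.
  by have := word_move_cat u' [::] m; rewrite !cats0.
- exact: rst_refl.
- exact: rst_sym.
- exact: rst_trans h1 h2.
Qed.

Lemma loop_homotopic x (p q : loop x) :
  walk_homotopic x x (val p) (val q) -> homotopic p q.
Proof.
suff h u v : walk_homotopic x x u v ->
    forall (xu : is_walk x u x) (xv : is_walk x v x),
    homotopic (Loop xu) (Loop xv).
  by case: p q => [u xu] [v xv] uv; apply: h.
elim=> [{}u {}v [_ _ m] xu xv|{}u xu xv|{}u {}v _ IH xv xu|u1 u2 u3 h1 IH1 _ IH2 x1 x3].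
- exact: rst_step.
- have -> : xu = xv by exact: bool_irrelevance.
  exact: rst_refl.
- exact/rst_sym/IH.
have x2 : is_walk x u2 x by rewrite -(walk_homotopic_is_walk h1).
exact: rst_trans (IH1 x1 x2) (IH2 x2 x3).
Qed.

End WalkHomotopy.

(** * Edge paths as words in the nerve *)

Section NerveWalks.
Variables (T : choiceType) (e : rel T) (l : nat).
Local Notation N := (nerve e l).
Local Notation vtx := (nerve_vertex e l).
Implicit Types (x y z : T) (p q : seq T).

(** When [y] is too far from [x] to give a 1-simplex, this is the degenerate
    letter at [x]; totality lets words be built from unchecked sequences. *)
Definition seg x y : letter N :=
  (true, insubd (nerve_degen ord0 (vtx x)) [tuple x; y]).

Lemma val_seg x y : ele (dist e x y) (Some l) -> val (seg x y).2 = [tuple x; y].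
Proof.
move=> xy; rewrite val_insubd /norm /=.
by case: (dist e x y) xy => [n|] //=; rewrite addn0 => ->.
Qed.

Lemma seg_val (u : N 1) x y : val u = [tuple x; y] -> (true, u) = seg x y.
Proof.
move=> ux; congr pair; apply: val_inj; rewrite val_insubd -ux.
by rewrite (valP u).
Qed.

Lemma lsrc_seg x y : ele (dist e x y) (Some l) -> lsrc (seg x y) = vtx x.
Proof.
move=> xy; apply: nerve_simp_eq => d k.
by rewrite nth_nerve_face val_seg //; case: k => [|[|k]].
Qed.

Lemma ltgt_seg x y : ele (dist e x y) (Some l) -> ltgt (seg x y) = vtx y.
Proof.
move=> xy; apply: nerve_simp_eq => d k.
by rewrite nth_nerve_face val_seg.
Qed.

Lemma walk_seg x y : ele (dist e x y) (Some l) ->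
  is_walk (vtx x) [:: seg x y] (vtx y).
Proof.
by move=> xy; apply/andP; split; apply/eqP; [apply: lsrc_seg | apply: ltgt_seg].
Qed.

Lemma seg_id x : walk_homotopic (vtx x) (vtx x) [:: seg x x] [::].
Proof.
have xx : ele (dist e x x) (Some l) by rewrite distxx.
apply: rst_step; split; [exact: walk_seg | exact: eqxx |].
have -> : seg x x = (true, degen (ord0 : 'I_1) (vtx x)).
  apply/esym/seg_val/val_inj/(@eq_from_nth _ x) => [|k _]; first by rewrite !size_tuple.
  by rewrite nth_nerve_degen; case: k => [|[|k]].
exact: (MoveDegen [::] [::]).
Qed.

Lemma seg_triangle x y z : ele (eadd (dist e x y) (dist e y z)) (Some l) ->
  walk_homotopic (vtx x) (vtx z) [:: seg x z] [:: seg x y; seg y z].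
Proof.
move=> xyz.
have xy := ele_trans (ele_addr _ (dist e y z)) xyz.
have yz := ele_trans (ele_addl (dist e x y) _) xyz.
have xz := ele_trans (dist_triangle e y x z) xyz.
have t_le : ele (norm e [tuple x; y; z]) (Some l).
  by rewrite /norm /=; case: (dist e y z) xyz => [n|] //=; rewrite addn0.
pose t : N 2 := exist _ [tuple x; y; z] t_le.
have xzE : (true, face (@Ordinal 3 1 isT) t) = seg x z.
  apply/seg_val/val_inj/(@eq_from_nth _ x) => [|k _]; first by rewrite !size_tuple.
  by rewrite nth_nerve_face; case: k => [|[|k]].
have xyE : (true, face ord_max t) = seg x y.
  apply/seg_val/val_inj/(@eq_from_nth _ x) => [|k _]; first by rewrite !size_tuple.
  by rewrite nth_nerve_face; case: k => [|[|[|k]]].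
have yzE : (true, face ord0 t) = seg y z.
  apply/seg_val/val_inj/(@eq_from_nth _ x) => [|k _]; first by rewrite !size_tuple.
  by rewrite nth_nerve_face.
apply: rst_step; split; [exact: walk_seg | |].
  exact: (walk_cat (walk_seg xy) (walk_seg yz)).
by have := MoveTriangle [::] [::] t; rewrite xzE xyE yzE.
Qed.

Fixpoint edges x p : seq (letter N) :=
  if p is y :: p' then seg x y :: edges y p' else [::].

Lemma edges_cat x p q : edges x (p ++ q) = edges x p ++ edges (last x p) q.
Proof. by elim: p x => //= y p IHp x; rewrite IHp. Qed.

Lemma dist_edge x y : e x y -> ele (dist e x y) (Some 1).
Proof. by move=> xy; apply: ele_dist; exists [:: y]; split; rewrite //= xy. Qed.

(** As in [path], the starting vertex is kept apart from the sequence
    of the vertices that follow it. *)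
Definition path_homotopic x p q : Prop :=
  [/\ path e x p, path e x q, last x p = last x q &
      walk_homotopic (vtx x) (vtx (last x p)) (edges x p) (edges x q)].

Lemma path_homotopic_refl x p : path e x p -> path_homotopic x p p.
Proof. by move=> xp; split=> //; apply: rst_refl. Qed.

Lemma path_homotopic_sym x p q : path_homotopic x p q -> path_homotopic x q p.
Proof. by case=> xp xq pq h; split=> //; rewrite -pq; apply: rst_sym. Qed.

Lemma path_homotopic_trans x p q r :
  path_homotopic x p q -> path_homotopic x q r -> path_homotopic x p r.
Proof.
case=> xp xq pq h1 [_ xr qr h2]; split=> //; first by rewrite pq.
by apply: rst_trans h1 _; rewrite pq.
Qed.

Hypothesis l_gt0 : 0 < l.

Lemma edge_near x y : e x y -> ele (dist e x y) (Some l).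
Proof. by move=> /dist_edge xy; apply: ele_trans xy _. Qed.

Lemma walk_edges x p : path e x p -> is_walk (vtx x) (edges x p) (vtx (last x p)).
Proof.
elim: p x => [|y p IHp] x => [_|/= /andP[/edge_near xy yp]]; first exact: eqxx.
exact: (walk_cat (walk_seg xy) (IHp _ yp)).
Qed.

Lemma path_homotopic_cat x p p' q q' :
  path_homotopic x p p' -> path_homotopic (last x p) q q' ->
  path_homotopic x (p ++ q) (p' ++ q').
Proof.
case=> xp xp' pp' hp [yq yq' qq' hq]; split.
- by rewrite cat_path xp.
- by rewrite cat_path xp' -pp'.
- by rewrite !last_cat -pp'.
rewrite !edges_cat -pp' last_cat.
exact: walk_homotopic_cat (walk_edges xp) (walk_edges yq) hp hq.
Qed.

End NerveWalks.

(** * Loops of the nerve are edge paths *)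

Section LowLength.
Variables (T : choiceType) (e : rel T).
Local Notation N := (nerve e 2).
Local Notation vtx := (nerve_vertex e 2).
Implicit Types (x y z : T) (p q : seq T).

Lemma path_seg x p : path e x p -> size p <= 2 ->
  walk_homotopic (vtx x) (vtx (last x p)) (edges e 2 x p) [:: seg e 2 x (last x p)].
Proof.
case: p => [|y [|z [|]]] //=.
- by move=> _ _; apply/rst_sym/seg_id.
- by move=> _ _; apply: rst_refl.
rewrite andbT => /andP[/dist_edge xy /dist_edge yz] _.
by apply/rst_sym/seg_triangle; apply: ele_trans (ele_add2 xy yz) _.
Qed.

(** The start of the induction on length: the norm of a triangle in the nerve is
    allowed to be 2, so paths of length at most 2 shrink to one 1-simplex. *)
Lemma short_path_homotopic x p q : path e x p -> path e x q ->
  last x p = last x q -> size p <= 2 -> size q <= 2 -> path_homotopic e 2 x p q.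
Proof.
move=> xp xq pq p2 q2; split=> //; apply: rst_trans (path_seg xp p2) _.
by rewrite pq; apply/rst_sym/path_seg.
Qed.

Hypothesis e_sym : symmetric e.

(** Backtracking over one edge is the triangle [(x, y, x)], of norm 2, whose long
    side is degenerate; the induction peels the path from the outside. *)
Lemma path_homotopic_rev x p : path e x p ->
  path_homotopic e 2 x (p ++ rev (belast x p)) [::].
Proof.
elim: p x => [|y p IHp] x /=; first by move=> _; apply: path_homotopic_refl.
move=> /andP[xy yp]; rewrite rev_cons -cats1 catA.
apply: (@path_homotopic_trans _ _ _ _ _ [:: y; x]).
  rewrite -cat1s -[[:: y; x]](cat1s y); apply: path_homotopic_cat => //=.
    by apply: path_homotopic_refl; rewrite /= xy.
  rewrite -[[:: x] in X in path_homotopic _ _ _ _ X]cat0s.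
  apply: path_homotopic_cat (IHp _ yp) _ => //.
  case: (IHp _ yp) => _ _ -> _.
  by apply: path_homotopic_refl; rewrite /= e_sym xy.
by apply: short_path_homotopic => //=; rewrite xy e_sym xy.
Qed.

Lemma vtx_thead (v : N 0) : v = vtx (thead (val v)).
Proof.
case: v => t t_le; apply: val_inj => /=; move: t {t_le}.
by case/tupleP=> x t; rewrite (tuple0 t) theadE.
Qed.

Lemma vtx_inj : injective vtx.
Proof. by move=> x y /(congr1 (fun v : N 0 => thead (val v))). Qed.

Lemma letter_seg (u : N 1) : exists x y p,
  [/\ path e x p, last x p = y, size p <= 2, ele (dist e x y) (Some 2)
    & (true, u) = seg e 2 x y].
Proof.
have [x [y uE]] : exists x y, val u = [tuple x; y].
  exists (tnth (val u) ord0), (tnth (val u) ord_max).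
  apply/val_inj/(@eq_from_nth _ (thead (val u))) => [|k].
    by rewrite !size_tuple.
  rewrite [size (val (val u))]size_tuple.
  by case: k => [|[|k]] //= _; rewrite (tnth_nth (thead (val u))).
have := valP u; rewrite uE /norm /=.
case xy: (dist e x y) => [n|//] /=; rewrite addn0 => n2.
have [p [pn xp py]] := dist_path xy.
by exists x, y, p; split=> //; [rewrite pn | rewrite xy | apply: seg_val].
Qed.

(** A positive letter is a segment, which expands to a geodesic [p].  An inverse
    segment [linv s] is compared with the reversed geodesic [q]: appending the
    null-homotopic [p q] to [linv s] and replacing [p] by [s] leaves [q]. *)
Lemma letter_edges x y (a : letter N) : lsrc a = vtx x -> ltgt a = vtx y ->
  exists p, [/\ path e x p, last x p = y &
    walk_homotopic (vtx x) (vtx y) [:: a] (edges e 2 x p)].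
Proof.
case: a => b u; have [x' [y' [p [xp py' p2 xy uE]]]] := letter_seg u.
case: b; rewrite ?uE => ax ay.
  move: ax ay; rewrite lsrc_seg // ltgt_seg // => /vtx_inj <- /vtx_inj <-.
  by exists p; split=> //; apply/rst_sym; rewrite -py'; apply: path_seg.
have aE : (false, u) = linv (seg e 2 x' y') by rewrite -uE.
move: ax ay; rewrite {}aE ltgt_inv lsrc_seg // -/(ltgt _) ltgt_seg //.
move=> /vtx_inj <- /vtx_inj <- {u uE x y}.
set s := seg e 2 x' y'; set q := rev (belast x' p).
have [_ _ _] := path_homotopic_rev xp; rewrite edges_cat last_cat py' -/q => loop_pq.
have [+ _ yq _] := path_homotopic_rev xp; rewrite cat_path last_cat py' in yq *.
rewrite xp /= -/q => xq; exists q; split => //.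
have ps := path_seg xp p2; rewrite py' -/s in ps.
have sw : is_walk (vtx y') [:: linv s] (vtx x') := walk_inv (walk_seg xy).
have pw := @walk_edges _ _ 2 isT _ _ xp; have qw := @walk_edges _ _ 2 isT _ _ xq.
rewrite py' yq in pw qw.
have refl (v v' : N 0) w : walk_homotopic v v' w w by apply: rst_refl.
have cancel : walk_homotopic (vtx y') (vtx y') ([:: linv s] ++ [:: s]) [::].
  apply: rst_step; split; [exact: walk_cat sw (walk_seg xy) | exact: eqxx |].
  by have := MoveCancel [::] [::] (linv s); rewrite linvK.
rewrite yq in loop_pq.
have h1 := walk_homotopic_cat sw (walk_cat pw qw) (refl _ _ _) loop_pq.
have h2 := walk_homotopic_cat (walk_cat sw pw) qw
  (walk_homotopic_cat sw pw (refl _ _ _) ps) (refl _ _ _).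
have h3 := walk_homotopic_cat (walk_cat sw (walk_seg xy)) qw cancel (refl _ _ _).
rewrite -catA in h2.
exact: rst_trans (rst_sym _ _ _ _ h1) (rst_trans _ _ _ _ _ h2 h3).
Qed.

Lemma walk_edgesP x y (w : seq (letter N)) : is_walk (vtx x) w (vtx y) ->
  exists p, [/\ path e x p, last x p = y &
    walk_homotopic (vtx x) (vtx y) w (edges e 2 x p)].
Proof.
elim: w x => [|a w IHw] x.
  by move=> /= /eqP[->]; exists [::]; split=> //; apply: rst_refl.
case/andP=> /eqP ax aw.
have [z az] : exists z, ltgt a = vtx z by exists (thead (val (ltgt a))); apply: vtx_thead.
have [p [xp pz ap]] := letter_edges ax az.
rewrite az in aw; have [q [zq qy wq]] := IHw _ aw.
exists (p ++ q); split; [by rewrite cat_path xp pz | by rewrite last_cat pz |].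
rewrite edges_cat pz -cat1s; apply: walk_homotopic_cat ap wq => //.
by apply/andP; split; apply/eqP.
Qed.

End LowLength.

(** * Low-degree magnitude chains *)

Section Chains.
Variables (T : choiceType) (e : rel T).
Local Open Scope ring_scope.

HB.instance Definition _ n l :=
  GRing.isZmodMorphism.Build (MC e n.+1 l) (MC e n l) (@mc_diff T e n l)
    (@mc_diff_additive T e n l).

Lemma cycle_boundary n l (c : MC e n.+1 l) :
  (forall h : MH e n.+1 l, h = 0) -> mc_diff c = 0 ->
  exists b : MC e n.+2 l, mc_diff b = c.
Proof.
move=> MH0 c0; have cZ : c \in @mc_cycle T e n.+1 l by rewrite inE c0.
have : (Cycle cZ - 0) \in @mc_boundary T e n.+1 l.
  by rewrite Quotient.idealrBE; apply/eqP; rewrite [LHS]MH0 [RHS]MH0.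
by rewrite subr0 inE => /asboolP.
Qed.

Definition live l (s : seq T) : bool :=
  sorted [rel x y | x != y] s && (norm e s == Some l).

(** The generator of a tuple, or 0 when the tuple is not one.  With this
    convention [mc_face] is [chain] of a deleted tuple, so differentials can be
    written without casing on which faces survive. *)
Definition chain n l (t : n.+1.-tuple T) : MC e n l :=
  if insub t is Some b then << b >> else 0.

Lemma chain_dead n l (t : n.+1.-tuple T) : live l t = false -> chain l t = 0.
Proof. by rewrite /chain => dead; rewrite insubF. Qed.

Lemma chain_basis n l (b : mc_basis e n l) : << b >> = chain l (val b).
Proof. by rewrite /chain valK. Qed.

Definition extend n l (g : seq T -> int) : MC e n l -> int :=
  fglift (fun b : mc_basis e n l => g (val b) : int^o).

HB.instance Definition _ n l g :=
  GRing.isZmodMorphism.Build (MC e n l) int (@extend n l g)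
    (@lift_is_additive _ _ int^o _).

Lemma extend_chain n l g (t : n.+1.-tuple T) :
  extend g (chain l t) = if live l t then g t else 0.
Proof.
rewrite /chain; case: insubP => [b live_t bt|dead_t].
  by rewrite /extend liftU scale1r bt ifT.
by rewrite raddf0 ifF //; apply: negbTE.
Qed.

Lemma diff_basis n l (b : mc_basis e n.+1 l) :
  mc_diff << b >> = \sum_(i < n.+2) (-1) ^+ i *: chain l (tdel i (val b)).
Proof. by rewrite /mc_diff liftU scale1r. Qed.

Lemma extend_diff0 n l g :
  (forall b : mc_basis e n.+1 l, extend g (mc_diff << b >>) = 0) ->
  forall c : MC e n.+1 l, extend g (mc_diff c) = 0.
Proof.
move=> g0 c; rewrite -[c]freeg_sumE !raddf_sum big1 // => b _.
by rewrite -[coeff b c]intz -freegU_mulz !raddfMz /= g0 mul0rz.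
Qed.

Lemma dist_eq0 x y : dist e x y = Some 0%N -> x = y.
Proof. by move=> /dist_path; case=> [[|z p] []]. Qed.

(** Deleting an end of a tuple loses the positive distance to its neighbour, so
    the outer faces never contribute to the differential. *)
Lemma live_cons l x y (s : seq T) :
  live l (x :: y :: s) -> live l (y :: s) = false.
Proof.
case/andP=> /andP[/= xy _]; rewrite /norm /= => nl; apply/negP => /andP[_].
move: nl; rewrite /norm /=; case: norm_from => [m|]; last by case: dist.
case xyd: (dist e x y) => [[|d]|] //; first by rewrite (dist_eq0 xyd) eqxx in xy.
by move=> /eqP[<-] /eqP[]; lia.
Qed.

Lemma norm_rcons x (s : seq T) y :
  norm e (rcons (x :: s) y) = eadd (norm e (x :: s)) (dist e (last x s) y).
Proof.
rewrite /norm /=; elim: s x => [|z s IHs] x /=; last by rewrite IHs eaddA.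
by case: dist => //= d; rewrite addn0.
Qed.

Lemma live_rcons l x y (s : seq T) :
  live l (rcons (x :: s) y) -> live l (x :: s) = false.
Proof.
case/andP=> + nl; rewrite /= rcons_path => /andP[_ /= sy]; apply/negP => /andP[_].
move: nl; rewrite norm_rcons => nl /eqP xs; move: nl; rewrite {}xs.
case syd: (dist e _ y) => [[|d]|] //; first by rewrite (dist_eq0 syd) eqxx in sy.
by move=> /= /eqP[]; lia.
Qed.

Lemma tdel_eq n (i : 'I_n.+1) (t : n.+1.-tuple T) (t' : n.-tuple T) :
  take i t ++ drop i.+1 t = t' -> tdel i t = t'.
Proof. by move=> tt'; apply: val_inj; rewrite /= tdelE. Qed.

Lemma diff_chain2 l x y z : live l [:: x; y; z] ->
  mc_diff (chain l [tuple x; y; z]) = - chain l [tuple x; z].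
Proof.
move=> xyz; pose b : mc_basis e 2 l := exist _ [tuple x; y; z] xyz.
have -> : chain l [tuple x; y; z] = << b >> by rewrite chain_basis.
rewrite diff_basis !big_ord_recl big_ord0 /= expr0 !scale1r.
rewrite (@tdel_eq _ _ _ [tuple y; z]) // (@tdel_eq _ _ _ [tuple x; z]) //.
rewrite (@tdel_eq _ _ _ [tuple x; y]) //.
rewrite (chain_dead (live_cons xyz)) (@chain_dead _ _ [tuple x; y]); last first.
  exact: (@live_rcons l x z [:: y]).
by rewrite add0r !addr0 expr1 scaleN1r.
Qed.

Lemma diff_chain3 l x a b z : live l [:: x; a; b; z] ->
  mc_diff (chain l [tuple x; a; b; z]) =
  chain l [tuple x; a; z] - chain l [tuple x; b; z].
Proof.
move=> xabz; pose t : mc_basis e 3 l := exist _ [tuple x; a; b; z] xabz.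
have -> : chain l [tuple x; a; b; z] = << t >> by rewrite chain_basis.
rewrite diff_basis !big_ord_recl big_ord0 /= expr0 !scale1r.
rewrite (@tdel_eq _ _ _ [tuple a; b; z]) // (@tdel_eq _ _ _ [tuple x; b; z]) //.
rewrite (@tdel_eq _ _ _ [tuple x; a; z]) // (@tdel_eq _ _ _ [tuple x; a; b]) //.
rewrite (chain_dead (live_cons xabz)) (@chain_dead _ _ [tuple x; a; b]); last first.
  exact: (@live_rcons l x z [:: a; b]).
by rewrite scaler0 add0r !addr0 expr1 scaleN1r addrC.
Qed.

End Chains.

(** * The induction on length *)

Section LengthInduction.
Variables (T : choiceType) (e : rel T) (k : nat).
Local Notation hom := (path_homotopic e 2).
Local Open Scope ring_scope.

Hypothesis e_irr : irreflexive e.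
Hypothesis k_ge2 : (2 <= k)%N.
Hypothesis MH2_eq0 : forall h : MH e 2 k.+1, h = 0.
Hypothesis hom_le : forall x p q, path e x p -> path e x q ->
  last x p = last x q -> (size p <= k)%N -> (size q <= k)%N -> hom x p q.

Definition short x p y : Prop := [/\ path e x p, last x p = y & (size p <= k)%N].

(** The class represented by the triple [(x, y, z)] is that of [c].  All paths of
    length at most [k] are admitted rather than geodesics only: by [hom_le] they
    represent the same class, and no geodesic has to be chosen. *)
Definition factors x c y z : Prop :=
  exists p q, [/\ short x p y, short y q z & hom x (p ++ q) c].

Lemma hom_short x p p' y : short x p y -> short x p' y -> hom x p p'.
Proof. by move=> [xp py pk] [xp' py' pk']; apply: hom_le; rewrite ?py. Qed.

Lemma hom_catl x p q q' : path e x p -> hom (last x p) q q' ->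
  hom x (p ++ q) (p ++ q').
Proof. by move=> xp; apply: path_homotopic_cat (path_homotopic_refl _ xp). Qed.

Lemma hom_catr x p p' q : hom x p p' -> path e (last x p) q ->
  hom x (p ++ q) (p' ++ q).
Proof.
by move=> pp' yq; apply: path_homotopic_cat pp' (path_homotopic_refl _ yq).
Qed.

Lemma factorsE x c y z p q : short x p y -> short y q z ->
  factors x c y z <-> hom x (p ++ q) c.
Proof.
move=> xpy yqz; split=> [[p' [q' [xpy' yqz' h]]]|h]; last by exists p, q.
apply: path_homotopic_trans h.
apply: path_homotopic_cat (hom_short xpy xpy') _ => //.
by case: (xpy) => _ -> _; apply: hom_short yqz yqz'.
Qed.

Definition class_count x c (s : seq T) : int :=
  if s is [:: x'; y; z] then `[< x' = x /\ factors x c y z >]%:R else 0.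

(** What a missing face means: if deleting [b] from [(a, b, z)] does not give a
    pair of distinct vertices at the full distance, the path through [b] is not
    a geodesic.  The case [a = z] is included, with the empty path. *)
Lemma shorter_face a b z p q : path e a p -> last a p = b -> path e b q ->
    last b q = z ->
  (forall m, dist e a z = Some m -> a != z -> m != (size p + size q)%N) ->
  (0 < size p)%N ->
  exists2 r, path e a r /\ last a r = z & (size r < size p + size q)%N.
Proof.
move=> ap pb bq qz not_geo p_gt0; have [<-|az] := eqVneq a z.
  by exists [::] => //=; lia.
have : ele (dist e a z) (Some (size p + size q)%N).
  by apply: ele_dist; exists (p ++ q); rewrite size_cat cat_path last_cat ap pb bq.
case azd: (dist e a z) => [m|] //= m_le.
have [r [rm ar rz]] := dist_path azd.
by exists r => //; rewrite rm ltn_neqAle m_le not_geo.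
Qed.

(** On [(x, a, b, z)] the functional compares two generators that both represent
    the concatenation [p ++ q ++ r] of geodesics, so it can only be nonzero if
    one of them is missing; then [q ++ r] or [p ++ q] has a shortcut, which
    makes the whole path homotopic to one of length at most [k], unlike [c]. *)
Lemma class_count_boundary x c (t : MC e 3 k.+1) :
  (forall s, (size s <= k)%N -> ~ hom x s c) ->
  extend (class_count x c) (mc_diff t) = 0.
Proof.
move=> c_long; apply: extend_diff0 => -[u u_live].
rewrite chain_basis /=; case/tupleP: u u_live => x' u; case/tupleP: u => a u.
case/tupleP: u => b u; case/tupleP: u => z u; rewrite (tuple0 u) => u_live.
rewrite (_ : [tuple of _] = [tuple x'; a; b; z]); last exact: val_inj.
rewrite diff_chain3 // raddfB /= !extend_chain.
have [x'x|x'x] := pselect (x' = x); last first.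
  by rewrite /= !asboolF ?if_same ?subrr //; case.
subst x'; case/andP: u_live => /= /and4P[xa ab bz _]; rewrite /norm /=.
case xad: (dist e x a) => [d1|//]; case abd: (dist e a b) => [d2|//].
case bzd: (dist e b z) => [d3|//] /eqP[]; rewrite addn0 => dk.
have [p [pd xp pa]] := dist_path xad; have [q [qd aq qb]] := dist_path abd.
have [r [rd br rz]] := dist_path bzd.
have d1_gt0 : (0 < d1)%N.
  by case: (d1) xad xa => // /dist_eq0->; rewrite eqxx.
have d2_gt0 : (0 < d2)%N.
  by case: (d2) abd ab => // /dist_eq0->; rewrite eqxx.
have d3_gt0 : (0 < d3)%N.
  by case: (d3) bzd bz => // /dist_eq0->; rewrite eqxx.
have aqr : path e a (q ++ r) by rewrite cat_path aq qb.
have xpq : path e x (p ++ q) by rewrite cat_path xp pa.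
have [pk rk qrk pqk] :
    [/\ size p <= k, size r <= k, size (q ++ r) <= k & size (p ++ q) <= k]%N.
  move: dk d1_gt0 d2_gt0 d3_gt0; rewrite !size_cat -pd -qd -rd; clear.
  by move=> *; split; lia.
have xpa : short x p a by [].
have brz : short b r z by [].
have aqrz : short a (q ++ r) z by rewrite /short last_cat qb.
have xpqb : short x (p ++ q) b by rewrite /short last_cat pa.
have count_a : factors x c a z <-> hom x (p ++ q ++ r) c by apply: factorsE.
have count_b : factors x c b z <-> hom x (p ++ q ++ r) c by rewrite catA; apply: factorsE.
(* The face that deletes [b] is missing. *)
have dead_a : live e k.+1 [:: x; a; z] = false -> ~ hom x (p ++ q ++ r) c.
  move=> dead h; have [||r' [ar' r'z] r'_lt] := @shorter_face a b z q r aq qb br rz.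
  - move=> m azd az; apply: (contraFN _ dead) => /eqP mE.
    rewrite /live /= xa az /norm /= xad azd /=; apply/eqP; congr Some.
    by rewrite mE qd rd addn0.
  - by rewrite qd.
  apply: (c_long (p ++ r')).
    by rewrite size_cat; move: r'_lt dk; rewrite -pd -qd -rd; clear; lia.
  apply: path_homotopic_trans h; apply: hom_catl => //; rewrite pa.
  apply: (@hom_short _ _ _ z) => //; split=> //.
  by apply: leq_trans qrk; rewrite size_cat ltnW.
(* The face that deletes [a] is missing. *)
have dead_b : live e k.+1 [:: x; b; z] = false -> ~ hom x (p ++ q ++ r) c.
  move=> dead h; have [||r' [xr' r'b] r'_lt] := @shorter_face x a b p q xp pa aq qb.
  - move=> m xbd xb; apply: (contraFN _ dead) => /eqP mE.
    rewrite /live /= xb bz /norm /= xbd bzd /=; apply/eqP; congr Some.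
    by rewrite mE pd qd addn0 -addnA.
  - by rewrite pd.
  apply: (c_long (r' ++ r)).
    by rewrite size_cat; move: r'_lt dk; rewrite -pd -qd -rd; clear; lia.
  apply: path_homotopic_trans h; rewrite catA; apply: hom_catr; last by rewrite r'b.
  apply: (@hom_short _ _ _ b) => //; split=> //.
  by apply: leq_trans pqk; rewrite size_cat ltnW.
have -> : `[< x = x /\ factors x c a z >] = `[< hom x (p ++ q ++ r) c >].
  by apply: asbool_equiv_eq; rewrite count_a; split=> [[]|].
have -> : `[< x = x /\ factors x c b z >] = `[< hom x (p ++ q ++ r) c >].
  by apply: asbool_equiv_eq; rewrite count_b; split=> [[]|].
case live_a: live; case live_b: live; rewrite ?subrr //.
  by rewrite asboolF ?subrr //; apply: dead_b.
by rewrite asboolF ?subrr //; apply: dead_a.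
Qed.

(** If the tail of [p] is not a geodesic, the induction hypothesis shortens it;
    if it is, the first edge of [p] splits off a generator. *)
Lemma split_first_edge x p : path e x p -> size p = k.+1 ->
  (exists2 s, (size s <= k)%N & hom x s p) \/
  exists y p', [/\ p = y :: p', live e k.+1 [:: x; y; last x p]
    & short x [:: y] y /\ short y p' (last x p)].
Proof.
case: p => [|y p] //= /andP[xy yp] [pk].
have xyd : dist e x y = Some 1%N.
  case xyd: (dist e x y) (dist_edge xy) => [[|[|d]]|] //= _.
  by rewrite (dist_eq0 xyd) e_irr in xy.
have yzd : ele (dist e y (last y p)) (Some k) by apply: ele_dist; exists p.
case yzE: (dist e y (last y p)) yzd => [d|//] /= d_le.
have [s [sd ys sz]] := dist_path yzE.
have [d_lt|d_ge] := ltnP d k; [left|right].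
  exists (y :: s); first by rewrite /= sd.
  apply: (@hom_catl _ [:: y]); rewrite /= ?xy //.
  by apply: (@hom_short _ _ _ (last y p)); split=> //; lia.
exists y, p; split=> //; last first.
  by split; split=> //=; rewrite ?xy ?pk //; lia.
have dk : d = k by apply/eqP; rewrite eqn_leq d_le.
rewrite /live /= /norm /= xyd yzE dk /= addn0 add1n eqxx !andbT.
apply/andP; split.
  by apply/eqP => xyE; rewrite xyE e_irr in xy.
by apply/eqP => yz; move: yzE; rewrite -yz distxx dk => -[k0]; move: k_ge2; rewrite -k0.
Qed.

(** The path [s] makes the ends of [p] closer than [k.+1], so the face [(x, z)]
    vanishes and the generator of [p] is a cycle. *)
Lemma hom_succ_short x p s : path e x p -> size p = k.+1 ->
  path e x s -> last x p = last x s -> (size s <= k)%N -> hom x p s.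
Proof.
move=> xp pk xs ps sk; apply: contrapT => no_hom.
have c_long s' : (size s' <= k)%N -> ~ hom x s' p.
  move=> s'k h; apply: no_hom; apply: path_homotopic_trans (path_homotopic_sym h) _.
  by case: h => xs' _ s'p _; apply: hom_le; rewrite // s'p.
have [[s' s'k h]|[y [p' [pE p_live [xy yp']]]]] := split_first_edge xp pk.
  exact: c_long h.
set z := last x p in p_live yp' *.
have cycle_p : mc_diff (chain e k.+1 [tuple x; y; z]) = 0.
  rewrite diff_chain2 // chain_dead ?oppr0 //.
  have : ele (dist e x z) (Some k).
    by apply: (@ele_trans (Some (size s))) => //; apply: ele_dist; exists s.
  rewrite /live /norm /=; case: dist => [m|] /=; rewrite ?andbF //.
  by move=> mk; apply/negP => /andP[_ /eqP[]]; lia.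
have [b /(congr1 (extend (class_count x p)))] := cycle_boundary MH2_eq0 cycle_p.
rewrite class_count_boundary // extend_chain p_live /= asboolT //.
by split=> //; exists [:: y], p'; split=> //; rewrite /= -pE; apply: path_homotopic_refl.
Qed.

(** The two generators have the same face [(x, z)], so their difference is a
    cycle whether or not that face survives; when a short path joins the ends
    the previous lemma applies instead. *)
Lemma hom_succ_succ x p q : path e x p -> size p = k.+1 ->
  path e x q -> size q = k.+1 -> last x p = last x q -> hom x p q.
Proof.
move=> xp pk xq qk pq.
have via_short s : path e x s -> last x s = last x p -> (size s <= k)%N -> hom x p q.
  move=> xs sp sk; apply: (@path_homotopic_trans _ _ _ _ _ s).
    exact: hom_succ_short.
  by apply/path_homotopic_sym/hom_succ_short; rewrite // -pq.
have [[s sk [xs _ sp _]]|[y [p' [pE p_live [xy yp']]]]] := split_first_edge xp pk.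
  exact: via_short sk.
have [[s sk [xs _ sq _]]|[y' [q' [qE q_live [xy' yq']]]]] := split_first_edge xq qk.
  by apply: via_short sk => //; rewrite pq.
have [[s [xs sp sk]]|no_short] := pselect (exists s, short x s (last x p)).
  exact: via_short sk.
have c_long s : (size s <= k)%N -> ~ hom x s p.
  by move=> sk [xs _ sp _]; apply: no_short; exists s.
rewrite -pq in q_live yq'; set z := last x p in p_live q_live yp' yq' *.
have cycle_pq :
    mc_diff (chain e k.+1 [tuple x; y; z] - chain e k.+1 [tuple x; y'; z]) = 0.
  by rewrite raddfB /= !diff_chain2 // subrr.
have [b /(congr1 (extend (class_count x p)))] := cycle_boundary MH2_eq0 cycle_pq.
rewrite class_count_boundary // raddfB /= !extend_chain p_live q_live /=.
rewrite asboolT; last first.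
  by split=> //; exists [:: y], p'; split=> //; rewrite /= -pE; apply: path_homotopic_refl.
case: asboolP => // -[_ /(factorsE _ xy' yq')]; rewrite /= -qE => qp _.
exact: path_homotopic_sym.
Qed.

Lemma hom_le_succ x p q : path e x p -> path e x q ->
  last x p = last x q -> (size p <= k.+1)%N -> (size q <= k.+1)%N -> hom x p q.
Proof.
move=> xp xq pq; rewrite leq_eqVlt => /predU1P[pk|pk]; last first.
  rewrite leq_eqVlt => /predU1P[qk|qk]; last exact: hom_le.
  exact/path_homotopic_sym/hom_succ_short.
rewrite leq_eqVlt => /predU1P[qk|qk]; first exact: hom_succ_succ.
exact: hom_succ_short.
Qed.

End LengthInduction.

Lemma all_paths_homotopic (T : choiceType) (e : rel T) (e_irr : irreflexive e)
    (MH2_eq0 : forall k : nat, 2 < k -> forall h : MH e 2 k, h = 0%R) x p q :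
  path e x p -> path e x q -> last x p = last x q -> path_homotopic e 2 x p q.
Proof.
suff H n : 2 <= n -> forall x p q, path e x p -> path e x q ->
    last x p = last x q -> size p <= n -> size q <= n -> path_homotopic e 2 x p q.
  move=> xp xq pq; apply: (H (size p + size q + 2)) => //; lia.
elim: n => // n IHn; rewrite leq_eqVlt => /predU1P[<-|n2].
  by move=> *; apply: short_path_homotopic.
by apply: hom_le_succ => //; [apply: MH2_eq0; lia | apply: IHn; lia].
Qed.

(** * The fundamental group *)

Theorem corollary4p21 (T : finType) (e : rel T)
    (e_irr : irreflexive e) (e_sym : symmetric e)
    (MH2_eq0 : forall k : nat, 2 < k -> forall h : MH e 2 k, h = 0%R)
    (x : T) :
  forall g : pi1_GLMY e x, g = 1%g.
Proof.
move=> g; have [w ->] := pi1_surj g; apply/pi1P/loop_homotopic.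
have [p [xp px w_p]] := walk_edgesP e_sym (valP w).
have [_ _ _] := all_paths_homotopic e_irr MH2_eq0 xp (isT : path e x [::]) px.
rewrite px; exact: rst_trans w_p.
Qed.
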